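(* Let $(a_{ij})_{(i,j)\in\mathbb{N}^2}$ be a family of elements of $\mathbb{K}$. Assume that $\sum_j a_{ij}$ converges for every $i\in\mathbb{N}$ and that $\sum_i\bigl(\sum_j |a_{ij}|\bigr)$ converges (in particular each inner series $\sum_j|a_{ij}|$ converges). Then the double series $\sum_{i,j} a_{ij}$ converges, the iterated series $\sum_j\bigl(\sum_i a_{ij}\bigr)$ converges (in particular $\sum_i a_{ij}$ converges for every $j$), and $$\sum_{i,j} a_{ij}=\sum_i\Bigl(\sum_j a_{ij}\Bigr)=\sum_j\Bigl(\sum_i a_{ij}\Bigr).$$
   Context: $\mathbb{K}$ is a non-Archimedean ordered field (i.e. it contains an element larger than every integer), equipped with its order topology, which is (Cauchy) complete and has a countable basis of neighbourhoods of $0$. $|x|=\max(x,-x)\in\mathbb{K}$. $\mathbb{N}=\{0,1,2,\dots\}$. A series $\sum_n c_n=\sum_{n=0}^\infty c_n$ in $\mathbb{K}$ converges to $c$ if its sequence of partial sums converges to $c$. A double series $\sum_{i,j}a_{ij}$ over $(i,j)\in\mathbb{N}^2$ is said to converge if, for a bijection $k\mapsto(\phi(k),\psi(k))$ from $\mathbb{N}$ to $\mathbb{N}^2$, the ordinary series $\sum_k a_{\phi(k),\psi(k)}$ converges; its sum is then by definition the sum of this ordinary series (convergence and sum do not depend on the chosen bijection). *)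

(* Defs.v *)
From HB Require Import structures.
From mathcomp Require Import all_boot all_order all_algebra.
From mathcomp Require Import boolp classical_sets functions cardinality filter.
From mathcomp Require Import reals topology normedtype sequences.

Set Implicit Arguments.
Unset Strict Implicit.
Unset Printing Implicit Defensive.

Import Order.TTheory GRing.Theory Num.Theory.
Import numFieldTopology.Exports numFieldNormedType.Exports.

Local Open Scope classical_set_scope.
Local Open Scope ring_scope.

(* With [numFieldTopology.Exports], a [realFieldType] carries the topology of
   the balls [`|x - y| < e]; by [real_order_nbhsE] it is the order topology. *)

Definition non_archimedean (K : numDomainType) : Prop :=
  exists x : K, forall n : int, n%:~R < x.

Definition cauchy_complete (T : puniformType) : Prop :=
  forall u : nat -> T, cauchy (u @ \oo) -> cvgn u.

Definition countable_nbhs_basis (T : topologicalType) (x : T) : Prop :=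
  exists2 B : set (set T), countable B & nbhs x = filter_from B id.

(* The double series over [nat * nat] converges to [s]. Convergence and sum do
   not depend on the enumeration of [nat * nat], so all of them are required to
   give [s]; [double_series_to_ex] shows that this is not vacuous. *)
Definition double_series_to (K : realFieldType) (a : nat -> nat -> K) (s : K)
    : Prop :=
  forall e : nat -> nat * nat, bijective e ->
    [series a (e k).1 (e k).2]_k @ \oo --> s.

Lemma double_series_to_ex (K : realFieldType) (a : nat -> nat -> K) (s : K) :
  double_series_to a s ->
  exists2 e : nat -> nat * nat, bijective e &
    [series a (e k).1 (e k).2]_k @ \oo --> s.
Proof.
move=> as_; have := card_nat2; rewrite card_eq_sym => /card_set_bijP[e].
by rewrite setTT_bijective => be; exists e => //; exact: as_.
Qed.

(* Main.v *)
(* Monotone bounded sequences need not converge in [K], so everything goes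
   through a Cauchy criterion. If [T] is the iterated sum of the [`|a i j|],
   every finite sum of them is at most [T], while some square box has a sum at
   least [T - e]; hence finite sums outside that box are at most [e]. This
   criterion is invariant under transposition, makes columns converge, and by
   completeness makes the sums over finite subsets of [nat * nat] converge
   as a net to some [s]. The double series and both iterated series are limits
   of sums over finite sets containing arbitrarily large boxes, so they equal
   [s]. *)

Require Import Defs.
From HB Require Import structures.
From mathcomp Require Import all_boot all_order all_algebra.
From mathcomp Require Import boolp classical_sets functions cardinality filter.
From mathcomp Require Import reals topology normedtype sequences.

Set Implicit Arguments.
Unset Strict Implicit.
Unset Printing Implicit Defensive.

Import Order.TTheory GRing.Theory Num.Theory.
Import numFieldTopology.Exports numFieldNormedType.Exports.

Local Open Scope classical_set_scope.
Local Open Scope ring_scope.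

Definition box (n : nat) : seq (nat * nat) :=
  [seq (i, j) | i <- index_iota 0 n, j <- index_iota 0 n].

Lemma mem_box (n : nat) (p : nat * nat) :
  (p \in box n) = (p.1 < n)%N && (p.2 < n)%N.
Proof.
case: p => i j; apply/allpairsP/andP => /= [[q [+ + [-> ->]]]|[ilt jlt]].
  by rewrite !mem_index_iota.
by exists (i, j); rewrite !mem_index_iota.
Qed.

Lemma box_uniq (n : nat) : uniq (box n).
Proof. by apply: allpairs_uniq; rewrite ?iota_uniq// => -[? ?] [? ?]. Qed.

Lemma box_subset (m n : nat) : (m <= n)%N -> {subset box m <= box n}.
Proof.
by move=> mn p; rewrite !mem_box => /andP[p1 p2]; rewrite !(leq_trans _ mn).
Qed.

Lemma seq_sub_box (G : seq (nat * nat)) : exists n, {subset G <= box n}.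
Proof.
elim: G => [|[i j] G [n Gn]]; first by exists 0.
exists (maxn n (maxn i j).+1) => p; rewrite inE => /predU1P[->|/Gn].
  by rewrite mem_box /= !leq_max !ltnS leq_maxl leq_maxr !orbT.
by apply: box_subset; rewrite leq_maxl.
Qed.

Lemma sum_box (V : nmodType) (f : nat * nat -> V) (n : nat) :
  \sum_(p <- box n) f p = \sum_(0 <= i < n) \sum_(0 <= j < n) f (i, j).
Proof. by rewrite big_allpairs. Qed.

Lemma sum_uniq_sub (V : nmodType) (I : eqType) (s t : seq I) (f : I -> V) :
  uniq s -> uniq t -> {subset s <= t} ->
  \sum_(x <- t) f x = \sum_(x <- s) f x + \sum_(x <- t | x \notin s) f x.
Proof.
move=> us ut st; rewrite (bigID (mem s)) /=; congr (_ + _).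
rewrite -big_filter; apply: perm_big; apply: uniq_perm => //.
  exact: filter_uniq.
by move=> x; rewrite mem_filter; case: (boolP (x \in s)) => //= /st.
Qed.

(* The Cauchy criterion for the sums over finite subsets of [nat * nat],
   represented by duplicate-free sequences. *)
Definition abs_summable (K : realFieldType) (a : nat -> nat -> K) : Prop :=
  forall e : K, 0 < e -> exists N : nat, forall G : seq (nat * nat),
    uniq G -> (forall p, p \in G -> p \notin box N) ->
    \sum_(p <- G) `|a p.1 p.2| <= e.

(* Convergence to [s] of the net of the sums over finite subsets. *)
Definition sums_to (K : realFieldType) (a : nat -> nat -> K) (s : K) : Prop :=
  forall e : K, 0 < e -> exists N : nat, forall G : seq (nat * nat),
    uniq G -> {subset box N <= G} -> `|s - \sum_(p <- G) a p.1 p.2| <= e.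

Lemma swap_uniq (G : seq (nat * nat)) :
  uniq [seq (p.2, p.1) | p <- G] = uniq G.
Proof. by apply: map_inj_uniq => -[i j] [k l] [-> ->]. Qed.

Lemma abs_summable_swap (K : realFieldType) (a : nat -> nat -> K) :
  abs_summable a -> abs_summable (fun i j => a j i).
Proof.
move=> sa e /sa[N aN]; exists N => G uG GN.
have := aN [seq (p.2, p.1) | p <- G]; rewrite big_map swap_uniq; apply => //.
by move=> _ /mapP[p /GN pN ->]; move: pN; rewrite !mem_box andbC.
Qed.

Lemma sums_to_swap (K : realFieldType) (a : nat -> nat -> K) (s : K) :
  sums_to a s -> sums_to (fun i j => a j i) s.
Proof.
move=> sa e /sa[N aN]; exists N => G uG GN.
have := aN [seq (p.2, p.1) | p <- G]; rewrite big_map swap_uniq; apply => //.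
move=> [i j] pN; apply/mapP; exists (j, i) => //.
by apply: GN; move: pN; rewrite !mem_box andbC.
Qed.

Lemma iterated_abs_summable (K : realFieldType) (a : nat -> nat -> K) :
  (forall i, cvgn [series `|a i j|]_j) ->
  cvgn [series limn [series `|a i j|]_j]_i ->
  abs_summable a.
Proof.
move=> cr; set B := fun i => limn _; set T := limn _ => cB.
have leB i n : \sum_(0 <= j < n) `|a i j| <= B i.
  apply: (@nondecreasing_cvgn_le K [series `|a i j|]_j) => //.
  exact: (@nondecreasing_series K (fun j => `|a i j|) xpredT 0%N).
have B0 i : 0 <= B i by have := leB i 0; rewrite big_geq.
(* The box lies in the first [n] rows, each bounded by its full sum [B i], and partial sums of the
   nonnegative [B i] stay below their limit [T]. *)
have leT n : \sum_(p <- box n) `|a p.1 p.2| <= T.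
  rewrite sum_box; apply: (@le_trans _ _ (series B n)).
    by rewrite /series /=; apply: ler_sum => i _; exact: leB.
  by apply: (nondecreasing_cvgn_le _ cB); exact: nondecreasing_series.
move=> e e0.
(* The tolerance [e] is shared: one half for dropping the rows from [N] on, the other for truncating
   the first [N] rows at column [m]. *)
have [N TN] : exists N, T - e / 2 <= series B N.
  have [|N _ TN] := @cvgr_ge _ _ _ _ _ _ cB (T - e / 2).
    by rewrite ltrBlDr ltrDl divr_gt0.
  by exists N; exact: TN (leqnn N).
have [m Nm Tm] : exists2 m, (N <= m)%N &
    series B N - e / 2 <= \sum_(0 <= i < N) \sum_(0 <= j < m) `|a i j|.
  have cN : \sum_(0 <= i < N) [series `|a i j|]_j m @[m --> \oo] --> series B N.
    by apply: cvg_big => [|i _]; [exact: add_continuous|exact: cr].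
  have [|m _ Tm] := @cvgr_ge _ _ _ _ _ _ cN (series B N - e / 2).
    by rewrite ltrBlDr ltrDl divr_gt0.
  by exists (maxn N m); [exact: leq_maxl|exact: Tm (leq_maxr _ _)].
(* [G] and [box m] are disjoint, so their concatenation is duplicate-free; it fits in a larger box,
   hence has absolute sum at most [T]. *)
exists m => G uG Gm; have [n Gn] := seq_sub_box (G ++ box m).
have uGm : uniq (G ++ box m).
  rewrite cat_uniq uG box_uniq andbT /=; apply/hasPn => p pm.
  by apply/negP => /Gm; rewrite pm.
have := leT n; rewrite (sum_uniq_sub _ uGm (box_uniq n) Gn) big_cat /=.
move=> /(le_trans _) le_T.
have {}le_T : \sum_(p <- G) `|a p.1 p.2| + \sum_(p <- box m) `|a p.1 p.2| <= T.
  by apply: le_T; rewrite lerDl sumr_ge0.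
rewrite -(lerD2r (\sum_(p <- box m) `|a p.1 p.2|)) (le_trans le_T)//.
rewrite -lerBlDl [e]splitr opprD addrA.
apply: (le_trans (lerB TN (lexx _))); apply: (le_trans Tm).
(* As [N <= m], the box contains the [N] by [m] rectangle; its other rows only add nonnegative
   terms. *)
rewrite sum_box [leRHS](@big_cat_nat _ _ _ N)//= lerDl.
by apply: sumr_ge0 => i _; exact: sumr_ge0.
Qed.

Lemma complete_cvgn (K : realFieldType) (u : nat -> K) :
  cauchy_complete K ->
  (forall e, 0 < e -> exists N, forall n, (N <= n)%N -> `|u N - u n| <= e) ->
  cvgn u.
Proof.
move=> complete cu; apply/complete/cauchy_exP => e e0.
(* Halving turns the weak bound into the strict one that open balls require. *)
have [|N uN] := cu (e / 2); first by rewrite divr_gt0.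
exists (u N); exists N => // n /uN le_e; rewrite /= -ball_normE /=.
by rewrite (le_lt_trans le_e)// gtr_pMr// invf_lt1 ?ltr1n.
Qed.

Lemma abs_summable_sums_to (K : realFieldType) (a : nat -> nat -> K) :
  cauchy_complete K -> abs_summable a -> exists s : K, sums_to a s.
Proof.
move=> complete sa.
(* Up to sign, the difference is the sum over the part of [G] outside [box n], which also avoids
   [box N]. *)
have tail e : 0 < e -> exists N, forall n G, (N <= n)%N -> uniq G ->
    {subset box n <= G} ->
    `|\sum_(p <- box n) a p.1 p.2 - \sum_(p <- G) a p.1 p.2| <= e.
  move=> /sa[N aN]; exists N => n G Nn uG nG.
  rewrite (sum_uniq_sub _ (box_uniq n) uG nG) opprD addNKr normrN.
  rewrite (le_trans (ler_norm_sum _ _ _))// -big_filter aN ?filter_uniq// => p.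
  by rewrite mem_filter => /andP[+ _]; apply/contra/box_subset.
pose u n := \sum_(p <- box n) a p.1 p.2.
have cu : cvgn u.
  apply: complete_cvgn => // e /tail[N aN]; exists N => n Nn.
  by apply: aN (box_uniq n) _ => //; exact: box_subset.
exists (limn u) => e e0; have e20 : 0 < e / 2 by rewrite divr_gt0.
have [N aN] := tail _ e20.
have [M _ uM] := @cvgr_dist_le _ _ _ _ _ _ _ cu _ e20.
exists (maxn N M) => G uG sG.
rewrite [e]splitr (le_trans (ler_distD (u (maxn N M)) _ _))// lerD//.
  by apply: uM; exact: leq_maxr.
by apply: aN => //; exact: leq_maxl.
Qed.

(** Initial segments of an enumeration are duplicate-free and eventually contain any given box. *)
Lemma sums_to_double_series (K : realFieldType) (a : nat -> nat -> K) (s : K) :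
  sums_to a s -> double_series_to a s.
Proof.
move=> sa e [d ed de]; apply/cvgrPdist_le => eps /sa[N aN].
have [M dM] : exists M, forall p, p \in box N -> (d p < M)%N.
  exists (\max_(p <- box N) d p).+1 => p pN.
  by rewrite ltnS; exact: (@leq_bigmax_seq _ _ xpredT).
exists M => // n Mn.
rewrite /series /= -(big_map e xpredT (fun p => a p.1 p.2)).
apply: aN; first by rewrite (map_inj_uniq (can_inj ed)) iota_uniq.
move=> p /dM dp; apply/mapP; exists (d p); last by rewrite de.
by rewrite mem_index_iota (leq_trans dp).
Qed.

(** For [n >= N], the sum of the first [n] full rows is the limit in [m] of sums over [n] by [m]
    rectangles. These contain [box N] once [m >= N], and the weak bound passes to the limit. *)
Lemma sums_to_iterated (K : realFieldType) (a : nat -> nat -> K) (s : K) :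
  (forall i, cvgn [series a i j]_j) -> sums_to a s ->
  [series limn [series a i j]_j]_i @ \oo --> s.
Proof.
move=> cr sa; apply/cvgrPdist_le => e /sa[N aN]; exists N => // n Nn.
have cn : `|s - \sum_(0 <= i < n) [series a i j]_j m| @[m --> \oo] -->
    `|s - [series limn [series a i j]_j]_i n|.
  apply: cvg_norm; apply: cvgB; first exact: cvg_cst.
  by apply: cvg_big => [|i _]; [exact: add_continuous|exact: cr].
rewrite -(cvg_lim _ cn)//; apply: limr_le.
  by apply/cvg_ex; eexists; exact: cn.
exists N => // m /= Nm; rewrite /series /=.
rewrite -(big_allpairs (F := fun p => a p.1 p.2)); apply: aN.
  by apply: allpairs_uniq; rewrite ?iota_uniq// => -[? ?] [? ?].
move=> [i j]; rewrite mem_box => /= /andP[iN jN].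
apply/allpairsP; exists (i, j).
by rewrite !mem_index_iota !(leq_trans iN, leq_trans jN).
Qed.

(** A stretch of a row from column [N] on avoids [box N], so the partial sums are Cauchy. *)
Lemma abs_summable_cvg_row (K : realFieldType) (a : nat -> nat -> K) (i : nat) :
  cauchy_complete K -> abs_summable a -> cvgn [series a i j]_j.
Proof.
move=> complete sa; apply: complete_cvgn => // e /sa[N aN].
exists N => n Nn; rewrite distrC sub_series_geq//.
rewrite (le_trans (ler_norm_sum _ _ _))//.
rewrite -(big_map (pair i) xpredT (fun p => `|a p.1 p.2|)).
apply: aN; first by rewrite map_inj_uniq ?iota_uniq// => ? ? [].
move=> _ /mapP[j + ->]; rewrite mem_index_iota mem_box /= => /andP[Nj _].
by rewrite [(j < N)%N]ltnNge Nj andbF.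
Qed.

Theorem theorem4p5 (K : realFieldType)
    (K_nonarch : non_archimedean K)
    (K_complete : cauchy_complete K)
    (K_basis : countable_nbhs_basis (0 : K))
    (a : nat -> nat -> K)
    (cvg_rows : forall i : nat, cvgn [series a i j]_j)
    (cvg_abs_rows : forall i : nat, cvgn [series `|a i j|]_j)
    (cvg_abs : cvgn [series limn [series `|a i j|]_j]_i) :
  exists s : K,
    [/\ double_series_to a s,
        [series limn [series a i j]_j]_i @ \oo --> s,
        forall j : nat, cvgn [series a i j]_i
      & [series limn [series a i j]_i]_j @ \oo --> s].
Proof.
have sa := iterated_abs_summable cvg_abs_rows cvg_abs.
have cvg_cols j : cvgn [series a i j]_i.
  exact: abs_summable_cvg_row (abs_summable_swap sa).
have [s as_] := abs_summable_sums_to K_complete sa.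
exists s; split => //; first exact: sums_to_double_series.
  exact: sums_to_iterated.
(* Columns are the rows of the transposed family, whose finite sums tend to the same [s]. *)
exact: sums_to_iterated (sums_to_swap as_).
Qed.
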